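(* Let $p\ge 5$ be a prime. For $C,D\in\mathbb{F}_p$ let $\mathcal{M}(C,D)$ be the cubic $x^2+y^2+z^2=xyz-C(x+y+z)+D$ over $\mathbb{F}_p$, and let $N_3$ be its number of nodes. Then: (a) If $\mathcal{M}(C,D)$ belongs neither to the Cayley family nor to the $K$ family, then $N_3=0$. (b) A cubic in the $K$ family, with parameter $K$, other than the Cayley cubic $\mathcal{M}(0,4)$, has exactly $N_3=1$ node, namely $(-K,-K,-K)$. (c) A cubic $\mathcal{M}(C,D)$ in the Cayley family, other than the Cayley cubic $\mathcal{M}(0,4)$ and the cubic $\mathcal{M}(8,-28)$, has exactly $N_3=3$ nodes, namely $(-2,-2,2-C/2)$, $(-2,2-C/2,-2)$ and $(2-C/2,-2,-2)$. The cubic $\mathcal{M}(8,-28)$ has exactly $N_3=1$ node. (d) The Cayley cubic $\mathcal{M}(0,4)$ has exactly $N_3=4$ nodes: $(-2,-2,2)$, $(-2,2,-2)$, $(2,-2,-2)$ and $(2,2,2)$.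
   Context: Let $f(x,y,z)=x^2+y^2+z^2-xyz+C(x+y+z)-D$. A node of $\mathcal{M}(C,D)$ is a point $(x,y,z)\in\mathbb{F}_p^3$ with $f=\partial_x f=\partial_y f=\partial_z f=0$ at $(x,y,z)$. The cubic $\mathcal{M}(C,D)$ belongs to the Cayley family if $D=4-2C-\frac{C^2}{4}$ in $\mathbb{F}_p$. It belongs to the $K$ family, with parameter $K\in\mathbb{F}_p$, if $C=K^2+2K$ and $D=-(2K^3+3K^2)$. *)

(* Defs.v *)
From HB Require Import structures.
From mathcomp Require Import all_boot all_order all_algebra.
From mathcomp Require Import mpoly.

Set Implicit Arguments.
Unset Strict Implicit.
Unset Printing Implicit Defensive.

Import GRing.Theory.
Local Open Scope ring_scope.

Section Cubic.
Variable p : nat.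
Implicit Types C D K : 'F_p.

(* The cubic M(C, D) is the zero locus of this polynomial, in the variables
   x = 'X_0, y = 'X_1, z = 'X_2. *)
Definition cubic C D : {mpoly 'F_p[3]} :=
  let x : {mpoly 'F_p[3]} := 'X_(@Ordinal 3 0 isT) in
  let y : {mpoly 'F_p[3]} := 'X_(@Ordinal 3 1 isT) in
  let z : {mpoly 'F_p[3]} := 'X_(@Ordinal 3 2 isT) in
  x ^+ 2 + y ^+ 2 + z ^+ 2 - x * y * z + C *: (x + y + z) - D%:MP.

Definition pt (x y z : 'F_p) : 3.-tuple 'F_p := [tuple x; y; z].

Definition nodes C D : {set 3.-tuple 'F_p} :=
  [set P : 3.-tuple 'F_p |
    ((cubic C D).@[tnth P] == 0) &&
    [forall i : 'I_3, ((cubic C D)^`M(i)).@[tnth P] == 0]].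

Definition N3 C D : nat := #|nodes C D|.

Definition cayley_family C D : Prop := D = 4 - 2 * C - C ^+ 2 / 4.

Definition K_family_at K C D : Prop :=
  C = K ^+ 2 + 2 * K /\ D = - (2 * K ^+ 3 + 3 * K ^+ 2).

Definition K_family C D : Prop := exists K : 'F_p, K_family_at K C D.

End Cubic.

(* Main.v *)
Require Import Defs.
From HB Require Import structures.
From mathcomp Require Import all_boot all_order all_algebra.
From mathcomp Require Import mpoly.
From mathcomp Require Import ring.

Set Implicit Arguments.
Unset Strict Implicit.
Unset Printing Implicit Defensive.

Import GRing.Theory.
Local Open Scope ring_scope.

(** Subtracting two of the equations [2x - yz + C = 0], [2y - xz + C = 0],
    [2z - xy + C = 0] gives [(x - y)(z + 2) = 0] and its permutations.  Hence a
    node is either diagonal, [(t, t, t)] with [C = t^2 - 2t] and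
    [D = 2t^3 - 3t^2], or a permutation of [(-2, -2, 2 - C/2)], and then the
    cubic lies in the Cayley family.  The diagonal node is unique: [t] is
    determined by [C] up to [t |-> 2 - t], and equality of the two values of [D]
    reads [4 (t - 1)^3 = 0].  Finally the cubic with parameter [K] lies in the
    Cayley family iff [(K - 2)^3 (K + 2) = 0], which singles out [M(8, -28)] and
    [M(0, 4)]. *)

Section CriticalPoints.
Variable F : fieldType.
Hypothesis two_neq0 : (2 : F) != 0.
Implicit Types C D K x y z s t : F.

Definition is_node C D x y z : Prop :=
  [/\ x ^+ 2 + y ^+ 2 + z ^+ 2 - x * y * z + C * (x + y + z) - D = 0,
      2 * x - y * z + C = 0, 2 * y - x * z + C = 0 & 2 * z - x * y + C = 0].

Definition is_diagonal_node C D x y z : Prop :=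
  [/\ x = y, y = z, C = x ^+ 2 - 2 * x & D = 2 * x ^+ 3 - 3 * x ^+ 2].

Definition is_cayley_node C D x y z : Prop :=
  D = 4 - 2 * C - C ^+ 2 / 4 /\
  [\/ [/\ x = -2, y = -2 & z = 2 - C / 2],
      [/\ x = -2, y = 2 - C / 2 & z = -2] |
      [/\ x = 2 - C / 2, y = -2 & z = -2]].

(** Certificates for deducing an equation from hypotheses: the caller gives the cofactors, and what
    remains is an identity for [ring]. *)
Lemma lincomb1 k x y s t : s = t -> x - y = k * (s - t) -> x = y.
Proof. by move=> -> /eqP; rewrite subrr mulr0 subr_eq0 => /eqP. Qed.

Lemma lincomb2 k l x y s t x' y' :
  s = t -> x' = y' -> x - y = k * (s - t) + l * (x' - y') -> x = y.
Proof. by move=> -> -> /eqP; rewrite !subrr !mulr0 addr0 subr_eq0 => /eqP. Qed.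

Lemma four_neq0 : (4 : F) != 0.
Proof. by rewrite (_ : 4 = 2 * 2) ?mulf_neq0 //; ring. Qed.

Lemma mul2rI x y : 2 * x = 2 * y -> x = y.
Proof. exact: (mulfI two_neq0). Qed.

(** With [w] standing for [2 - C / 2], the Cayley condition loses its denominator, so that [ring]
    can handle it. *)
Lemma half_cayley C D w : 2 * w = 4 - C ->
  (D = 4 - 2 * C - C ^+ 2 / 4) <-> (D = 8 * w - w ^+ 2 - 8).
Proof.
move=> hw; have -> : C = 4 - 2 * w by apply: (lincomb1 (k := 1) hw); ring.
have -> : 4 - 2 * (4 - 2 * w) - (4 - 2 * w) ^+ 2 / 4 = 8 * w - w ^+ 2 - 8.
  by field; exact: four_neq0.
by [].
Qed.

Lemma is_nodeP C D x y z :
  is_node C D x y z <-> is_diagonal_node C D x y z \/ is_cayley_node C D x y z.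
Proof.
have hw : 2 * (2 - C / 2) = 4 - C by field.
rewrite /is_cayley_node (half_cayley D hw); set w := 2 - C / 2 in hw *.
have w_eq u : 2 * u = 4 - C -> u = w by move=> hu; apply: mul2rI; rewrite hu hw.
split=> [[f0 fx fy fz]|].
  have xy : x != y -> z = -2.
    rewrite -subr_eq0 => /mulfI; apply; apply: (lincomb2 (k := 1) (l := -1) fx fy); ring.
  have xz : x != z -> y = -2.
    rewrite -subr_eq0 => /mulfI; apply; apply: (lincomb2 (k := 1) (l := -1) fx fz); ring.
  have yz : y != z -> x = -2.
    rewrite -subr_eq0 => /mulfI; apply; apply: (lincomb2 (k := 1) (l := -1) fy fz); ring.
  have [exy|nxy] := eqVneq x y; have [eyz|nyz] := eqVneq y z.
  - left; subst z y; split=> //; first by apply: (lincomb1 (k := 1) fx); ring.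
    (* The cofactor [3 * x] is the coordinate sum, the coefficient of [C] in [f0], so [C] cancels.
       In the cases below the coordinate sum is [w - 4]. *)
    by apply: (lincomb2 (k := -1) (l := 3 * x) f0 fx); ring.
  - have ex := yz nyz; right; subst y x.
    have ez : z = w by apply: w_eq; apply: (lincomb1 (k := 1) fx); ring.
    subst z; split; last by constructor 1.
    by apply: (lincomb2 (k := -1) (l := w - 4) f0 hw); ring.
  - have ez := xy nxy; right; subst y z.
    have ex : x = w by apply: w_eq; apply: (lincomb1 (k := 1) fy); ring.
    subst x; split; last by constructor 3.
    by apply: (lincomb2 (k := -1) (l := w - 4) f0 hw); ring.
  - have ez := xy nxy; have ex := yz nyz; right; subst x z.
    have ey : y = w by apply: w_eq; apply: (lincomb1 (k := 1) fx); ring.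
    subst y; split; last by constructor 2.
    by apply: (lincomb2 (k := -1) (l := w - 4) f0 hw); ring.
case=> [[-> -> -> ->]|[-> h]]; first by split; ring.
have -> : C = 4 - 2 * w by apply: (lincomb1 (k := 1) hw); ring.
by case: h => -[-> -> ->]; split; ring.
Qed.

Lemma diagonal_node_uniq s t :
  t ^+ 2 - 2 * t = s ^+ 2 - 2 * s ->
  2 * t ^+ 3 - 3 * t ^+ 2 = 2 * s ^+ 3 - 3 * s ^+ 2 -> t = s.
Proof.
move=> hC hD; have [//|nts] := eqVneq t s.
have hs : s = 2 - t.
  by apply/(mulfI (_ : t - s != 0)); rewrite ?subr_eq0 //; apply: (lincomb1 (k := 1) hC); ring.
have /eqP : 4 * (t - 1) ^+ 3 = 0 by rewrite hs in hD; apply: (lincomb1 (k := 1) hD); ring.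
rewrite mulf_eq0 (negPf four_neq0) expf_eq0 /= subr_eq0 => /eqP t1.
by rewrite hs t1; ring.
Qed.

Lemma K_cayley K :
  - (2 * K ^+ 3 + 3 * K ^+ 2) =
    4 - 2 * (K ^+ 2 + 2 * K) - (K ^+ 2 + 2 * K) ^+ 2 / 4 ->
  K = 2 \/ K = -2.
Proof.
move=> h; have /eqP : (K - 2) ^+ 3 * (K + 2) = 0.
  have -> : (K - 2) ^+ 3 * (K + 2) = 4 * (- (2 * K ^+ 3 + 3 * K ^+ 2) -
    (4 - 2 * (K ^+ 2 + 2 * K) - (K ^+ 2 + 2 * K) ^+ 2 / 4)).
    by field; exact: four_neq0.
  by rewrite h subrr mulr0.
rewrite mulf_eq0 expf_eq0 /= subr_eq0 addr_eq0.
by case/orP=> /eqP; [left|right].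
Qed.

Lemma neq_opp2 : (2 : F) != -2.
Proof.
rewrite -subr_eq0 (_ : 2 - -2 = 4) ?four_neq0 //; ring.
Qed.

Lemma neq_cayley_cubic : ((8, -28) : F * F) <> (0, 4).
Proof.
apply/eqP; rewrite xpair_eqE negb_and (_ : 8 = 2 * 4); last by ring.
by rewrite mulf_neq0 ?four_neq0.
Qed.

End CriticalPoints.

Section Nodes.
Variable p : nat.
Implicit Types (C D x y z : 'F_p) (P : 3.-tuple 'F_p).

Lemma tuple3_pt P : exists x y z, P = pt x y z.
Proof.
case/tupleP: P => x P; case/tupleP: P => y P; case/tupleP: P => z P.
by exists x, y, z; apply/val_inj; rewrite /= (tuple0 P).
Qed.

Lemma eq_pt x y z x' y' z' :
  (pt x y z == pt x' y' z') = [&& x == x', y == y' & z == z'].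
Proof. by rewrite -val_eqE /= !eqseq_cons andbT. Qed.

Lemma mderivXU (R : comNzRingType) n (i j : 'I_n) :
  ('X_j : {mpoly R[n]})^`M(i) = (j == i)%:R%:MP.
Proof.
rewrite mderivX mnm1E; case: eqP => [->|_]; last by rewrite scale0r mpolyC0.
by rewrite -{1}(add0m U_(i)%MM) addmK mpolyX0 scale1r mpolyC1.
Qed.

(** Bridge from the formal partial derivatives of [cubic] to explicit equations, after which only
    field algebra remains. *)
Lemma nodesP C D x y z :
  reflect (is_node C D x y z) (pt x y z \in nodes C D).
Proof.
(* [v] is kept abstract: unification diverges on the unfoldable [tnth (pt _ _ _)]. *)
have [v vE] : {v | v = tnth (pt x y z)} by exists (tnth (pt x y z)).
(* Differentiation is done for a symbolic index [i], leaving Kronecker deltas; [i] is split only at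
   the end. *)
have df_eval i : ((cubic C D)^`M(i)).@[v] =
    [tuple 2 * x - y * z + C; 2 * y - x * z + C; 2 * z - x * y + C]`_i.
  rewrite /cubic !expr2 !(mderivB, mderivD, mderivM, mderivZ, mderivC, mderivXU).
  rewrite !mevalB !mevalD mevalN !mevalZ !mevalD !mevalM !mevalD !mevalM.
  rewrite !mevalXU !mevalC.
  by case: i => [[|[|[|//]]] ilt]; rewrite vE /= !(tnth_nth 0) /=; ring.
have f_eval : (cubic C D).@[v] =
    x ^+ 2 + y ^+ 2 + z ^+ 2 - x * y * z + C * (x + y + z) - D.
  rewrite /cubic !expr2 mevalB !mevalD mevalN mevalZ !mevalD !mevalM.
  by rewrite !mevalXU mevalC vE !(tnth_nth 0).
rewrite inE -vE f_eval.
apply: (iffP andP) => [[/eqP f0 /forallP df]|[f0 fx fy fz]].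
  have df0 i := eqP (df i).
  by split=> //; [have := df0 (@Ordinal 3 0 isT)|have := df0 (@Ordinal 3 1 isT)|
    have := df0 (@Ordinal 3 2 isT)]; rewrite df_eval.
split; first exact/eqP.
by apply/forallP=> i; rewrite df_eval; case: i => [[|[|[|//]]] ilt] /=; apply/eqP.
Qed.

Lemma nodes_eqP C D (A : {set 3.-tuple 'F_p}) :
  (forall x y z, is_node C D x y z <-> pt x y z \in A) -> nodes C D = A.
Proof.
move=> h; apply/setP=> P; have [x [y [z ->]]] := tuple3_pt P.
by apply/nodesP/idP => /h.
Qed.

End Nodes.

Theorem theorem10p1 (p : nat) (p_prime : prime p) (p_ge5 : (5 <= p)%N) :
  (* (a) *)
  (forall C D : 'F_p, ~ cayley_family C D -> ~ K_family C D -> N3 C D = 0%N) /\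
  (* (b) *)
  (forall K C D : 'F_p, K_family_at K C D -> (C, D) <> (0, 4) ->
     N3 C D = 1%N /\ nodes C D = [set pt (- K) (- K) (- K)]) /\
  (* (c) *)
  ((forall C D : 'F_p, cayley_family C D ->
      (C, D) <> (0, 4) -> (C, D) <> (8, - 28) ->
      N3 C D = 3%N /\
      nodes C D = [set pt (- 2) (- 2) (2 - C / 2);
                       pt (- 2) (2 - C / 2) (- 2);
                       pt (2 - C / 2) (- 2) (- 2)]) /\
   N3 (8 : 'F_p) (- 28) = 1%N) /\
  (* (d) *)
  (N3 (0 : 'F_p) 4 = 4%N /\
   nodes (0 : 'F_p) 4 = [set pt (- 2) (- 2) 2; pt (- 2) 2 (- 2);
                             pt 2 (- 2) (- 2); pt 2 2 2]).
Proof.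
have two_neq0 : (2 : 'F_p) != 0.
  rewrite -(dvdn_pcharf (pchar_Fp p_prime)) gtnNdvd //.
  exact: leq_trans p_ge5.
have nodeP := is_nodeP two_neq0.
(* This serves (b) and, at [K = 2], the cubic M(8, -28) of (c). *)
have nodesK (K C D : 'F_p) : K_family_at K C D -> (C, D) <> (0, 4) ->
    nodes C D = [set pt (- K) (- K) (- K)].
  case=> -> -> notCayley; apply: nodes_eqP => x y z.
  rewrite nodeP inE eq_pt; split=> [[[<- <- hC hD]|[hD h]]|].
  - rewrite (diagonal_node_uniq two_neq0 (s := - K) (t := x)) ?eqxx //.
      by rewrite -hC; ring.
    by rewrite -hD; ring.
  (* A node of Cayley type puts the cubic in both families. [K = -2] is the excluded M(0, 4); for
     [K = 2] the three Cayley nodes collapse to (-2, -2, -2), the diagonal node. *)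
  - case: (K_cayley two_neq0 hD) => K2; last first.
      by case: notCayley; rewrite K2; congr pair; ring.
    have e2 : 2 - (K ^+ 2 + 2 * K) / 2 = -2 by rewrite K2; field.
    by move: h; rewrite e2 K2; case=> -[-> -> ->]; rewrite eqxx.
  - by case/and3P=> /eqP-> /eqP-> /eqP->; left; split=> //; ring.
split=> [C D notCayley notK|].
  rewrite /N3 (_ : nodes C D = set0) ?cards0 //.
  apply: nodes_eqP => x y z; rewrite nodeP inE; split=> // -[[_ _ hC hD]|[]//].
  (* The diagonal node of the [K] family has coordinates [- K], hence the witness. *)
  by case: notK; exists (- x); rewrite /K_family_at hC hD; split; ring.
split=> [K C D famK notCayley|].
  by rewrite /N3 (nodesK K) // cards1.
split.
  split=> [C D famC n04 n828|]; last first.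
    rewrite /N3 (nodesK 2) ?cards1 //; first by split; ring.
    exact: neq_cayley_cubic.
  rewrite /N3; have -> : nodes C D = [set pt (- 2) (- 2) (2 - C / 2);
       pt (- 2) (2 - C / 2) (- 2); pt (2 - C / 2) (- 2) (- 2)].
    apply: nodes_eqP => x y z; rewrite nodeP !inE !eq_pt.
    split=> [[[_ _ hC hD]|[_ h]]|].
    (* A diagonal node would put the cubic in the [K] family too, leaving only the two excluded
       cubics. *)
    + move: famC n04 n828; rewrite hC hD /cayley_family => famC n04 n828.
      case: (@K_cayley _ two_neq0 (- x)) => [|x2|x2].
      - rewrite (_ : (- x) ^+ 2 + 2 * (- x) = x ^+ 2 - 2 * x); last by ring.
        by rewrite -famC; ring.
      - by case: n828; rewrite -[x]opprK x2; congr pair; ring.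
      - by case: n04; rewrite -[x]opprK x2; congr pair; ring.
    + by case: h => -[-> -> ->]; rewrite !eqxx ?orbT.
    + move=> h; right; split=> //.
      by case/orP: h => [/orP[]|] /and3P[/eqP-> /eqP-> /eqP->];
        [constructor 1|constructor 2|constructor 3].
  split=> //; rewrite -setUA cardsU1 cards2 !inE !eq_pt.
  (* The three nodes are distinct unless [2 - C / 2 = -2]; then [C = 8], and the Cayley relation
     gives [D = -28]. *)
  have w_neq : (2 - C / 2 == -2) = false.
    apply/eqP=> w2; case: n828; rewrite famC.
    have -> : C = 8.
      have -> : C = 4 - 2 * (2 - C / 2) by field.
      by rewrite w2; ring.
    by congr pair; field; exact: four_neq0.
  by rewrite (eq_sym (-2) (2 - C / 2)) w_neq ?andbF.
(* Here both kinds of node occur: three of Cayley type, with [2 - C / 2 = 2], and the diagonal one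
   for [K = -2]. They are distinct because [2] differs from [-2]. *)
rewrite /N3; have -> : nodes (0 : 'F_p) 4 = [set pt (- 2) (- 2) 2; pt (- 2) 2 (- 2);
                             pt 2 (- 2) (- 2); pt 2 2 2].
  apply: nodes_eqP => x y z; rewrite nodeP /is_cayley_node !inE !eq_pt.
  rewrite mul0r subr0; split=> [[[<- <- hC hD]|[_ h]]|].
  - rewrite (diagonal_node_uniq two_neq0 (s := 2) (t := x)) ?eqxx ?orbT //.
      by rewrite -hC; ring.
    by rewrite -hD; ring.
  - by case: h => -[-> -> ->]; rewrite !eqxx ?orbT.
  - rewrite -!orbA; case/or4P=> /and3P[/eqP-> /eqP-> /eqP->].
    + by right; split; [ring|constructor 1].
    + by right; split; [ring|constructor 2].
    + by right; split; [ring|constructor 3].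
    + by left; split=> //; ring.
split=> //; rewrite -!setUA !cardsU1 cards1 !inE !eq_pt.
by rewrite !(eq_sym (-2) 2) !(negPf (neq_opp2 two_neq0)) !andbF.
Qed.
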